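(* Let $\mathbb{H}=[0,\infty)$ and let $\mathbb{H}^*=\beta\mathbb{H}\setminus\mathbb{H}$ be its Čech-Stone remainder. The surjective span $\sigma^*(\mathbb{H}^* )$ is nonzero; that is, there is a subcontinuum $Z$ of $\mathbb{H}^*\times\mathbb{H}^*$ with $\pi_1[Z]=\pi_2[Z]=\mathbb{H}^*$ and $Z\cap\Delta(\mathbb{H}^* )=\emptyset$.
   Context: A continuum is a (nonempty) compact connected Hausdorff space; a subcontinuum is a subspace that is a continuum. $\beta X$ denotes the Čech-Stone compactification of $X$. For a continuum $X$, $\Delta(X)=\{(x,x):x\in X\}$ and $\pi_1,\pi_2:X^2\to X$ are the coordinate projections. The surjective span $\sigma^*(X)$ of a continuum $X$ is zero if every subcontinuum $Z$ of $X^2$ with $\pi_1[Z]=\pi_2[Z]=X$ meets $\Delta(X)$; otherwise it is nonzero. *)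

(* Defs.v *)
From HB Require Import structures.
From mathcomp Require Import all_boot all_order all_algebra.
From mathcomp Require Import all_classical all_reals all_analysis.

Set Implicit Arguments.
Unset Strict Implicit.
Unset Printing Implicit Defensive.

Import Order.TTheory GRing.Theory Num.Theory.
Import numFieldNormedType.Exports.

Local Open Scope classical_set_scope.
Local Open Scope ring_scope.

(* [A : topologicalType] below is the subtype [set_type A] with the topology
   induced from [T]. *)
Definition is_continuum (T : topologicalType) (A : set T) : Prop :=
  [/\ A !=set0, compact A, connected A & hausdorff_space (A : topologicalType)].

(* Intended for spaces [X] such that [is_continuum [set: X]]. *)
Definition surjective_span_zero (X : topologicalType) : Prop :=
  forall Z : set (X * X), is_continuum Z ->
    fst @` Z = [set: X] -> snd @` Z = [set: X] -> Z `&` diagonal !=set0.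

Definition unit_interval (R : realType) : topologicalType :=
  (`[0, 1]%classic : set R).

Definition tychonoff_cube (R : realType) (X : topologicalType) :
  topologicalType :=
  prod_topology (fun _ : continuousType X (unit_interval R) => unit_interval R).

Definition cech_stone_eval (R : realType) (X : topologicalType) (x : X) :
  tychonoff_cube R X := fun f => f x.

(* Cech's construction: for Tychonoff [X] the evaluation map is an embedding,
   and its image, a copy of [X], is dense in beta X. *)
Definition cech_stone (R : realType) (X : topologicalType) :
  set (tychonoff_cube R X) := closure (range (@cech_stone_eval R X)).

Arguments cech_stone R X : clear implicits.

Definition cech_stone_remainder (R : realType) (X : topologicalType) :
  set (tychonoff_cube R X) :=
  cech_stone R X `\` range (@cech_stone_eval R X).

Arguments cech_stone_remainder R X : clear implicits.

Definition half_line (R : realType) : topologicalType :=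
  (`[0, +oo[%classic : set R).

Definition half_line_remainder (R : realType) : topologicalType :=
  cech_stone_remainder R (half_line R).

(* Main.v *)
(* The witness is the graph of the extension to H* of the translation
   t |-> t + pi of H = [0, oo). Since H* is the intersection of the closures in
   beta H of the tails [n, oo), it is a continuum and the extension maps it onto
   itself. The extension has no fixed point: translation by pi changes the sign
   of cos and of sin, so at a fixed point the extensions of both functions would
   vanish, although the sum of their squares is 1. *)

Require Import Defs.
From HB Require Import structures.
From mathcomp Require Import all_boot all_order all_algebra.
From mathcomp Require Import all_classical all_reals all_analysis.
From mathcomp Require Import ring lra.

Set Implicit Arguments.
Unset Strict Implicit.
Unset Printing Implicit Defensive.

Import Order.TTheory GRing.Theory Num.Theory.
Import numFieldNormedType.Exports.

Local Open Scope classical_set_scope.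
Local Open Scope ring_scope.

(** * Decreasing intersections of closed sets in a compact space *)

(** The sets [K n] generate a proper filter; a cluster point of it lies in every [K n] because these
    are closed. *)
Lemma nested_compact_bigcap_nonempty (T : topologicalType) (K : nat -> set T) :
  compact [set: T] ->
  (forall n, closed (K n)) -> (forall m n, (m <= n)%N -> K n `<=` K m) ->
  (forall n, K n !=set0) -> \bigcap_n K n !=set0.
Proof.
move=> cT Kcl Kdecr K0.
have FF : Filter (filter_from [set: nat] K).
  apply: filter_from_filter; first by exists 0%N.
  move=> i j _ _; exists (maxn i j) => // x Kx; split.
  - exact: (Kdecr _ _ (leq_maxl i j) _ Kx).
  - exact: (Kdecr _ _ (leq_maxr i j) _ Kx).
have PF : ProperFilter (filter_from [set: nat] K).
  by apply: filter_from_proper => // i _; exact: K0.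
have [|p [_ pK]] := cT _ PF; first by exists 0%N.
exists p => n _; apply: Kcl => B pB.
by apply: pK => //; exists n.
Qed.

(* [R] is only the codomain of the Urysohn functions behind [normal_openP]. *)
Lemma nested_bigcap_connected (R : realType) (T : topologicalType)
    (K : nat -> set T) :
  hausdorff_space T -> compact [set: T] ->
  (forall n, closed (K n)) -> (forall m n, (m <= n)%N -> K n `<=` K m) ->
  (forall n, connected (K n)) -> connected (\bigcap_n K n).
Proof.
move=> hT cT Kcl Kdecr Kconn.
pose L := \bigcap_n K n.
have Lcl : closed L by exact: closed_bigI.
apply/connectedP => E [E0 LE [sep1 sep2]].
have disj1 x : closure (E false) x -> E true x -> False.
  by move=> Ef Et; have : (closure (E false) `&` E true) x by []; rewrite sep1.
have disj2 x : E false x -> closure (E true) x -> False.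
  by move=> Ef Et; have : (E false `&` closure (E true)) x by []; rewrite sep2.
(* A closure point of one piece stays in the closed set [L], and separation keeps it out of the
   other piece. So both pieces are closed in [T], and normality applies to them. *)
have Ecl b : closed (E b).
  move=> x Ex; have : (E false `|` E true) x.
    rewrite -LE; apply: Lcl; apply: closureS Ex => y Ey.
    by rewrite /L LE; case: b Ey => Ey; [right|left].
  by case: b Ex => Ex [] // Ebx; [case: (disj2 x)|case: (disj1 x)].
have EI x : E false x -> E true x -> False.
  by move/subset_closure; exact: disj1.
have [U [V [oU oV EU EV UV0]]] : exists U V : set T,
    [/\ open U, open V, E false `<=` U, E true `<=` V & U `&` V = set0].
  have /(@normal_openP R) := compact_normal hT cT; apply => //.
  by rewrite -subset0 => x [? /EI].
(* If every [N n] were nonempty, compactness would give a point of [L] outside [U] and [V]. Hence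
   some single [K n] is already covered by [U] and [V]. *)
pose N n := K n `&` ~` (U `|` V).
have [n NE] : exists n, ~ (N n !=set0).
  apply: contrapT => /forallNP Nn.
  have [|||x Nx] := @nested_compact_bigcap_nonempty _ N cT.
  - by move=> n; apply: closedI => //; exact/open_closedC/openU.
  - by move=> m n mn x [/(Kdecr _ _ mn) Kx ?].
  - by move=> n; apply: contrapT; exact: Nn.
  have [Efx|Etx] : (E false `|` E true) x.
  - by rewrite -LE => n _; have [] := Nx n I.
  - by have [_] := Nx 0%N I; apply; left; exact: EU.
  - by have [_] := Nx 0%N I; apply; right; exact: EV.
have KUV : K n `<=` U `|` V.
  by move=> x Kx; apply: contrapT => UVx; apply: NE; exists x.
have LK : E false `|` E true `<=` K n by rewrite -LE => x; exact.
have sepUV : separated U V.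
  have sep V1 V2 : open V2 -> V1 `&` V2 = set0 -> closure V1 `&` V2 = set0.
    move=> oV2 V12; rewrite -subset0 => x [V1x V2x].
    by have [y] := V1x V2 (open_nbhs_nbhs (conj oV2 V2x)); rewrite V12.
  split; first exact: sep.
  by rewrite setIC; apply: sep; rewrite // setIC.
have [xf Ef] := E0 false; have [xt Et] := E0 true.
(* Being connected, [K n] falls inside one of the disjoint sets [U] and [V], but it contains points
   of both pieces. *)
have [KU|KV] := connected_subset sepUV KUV (Kconn n).
- have : (U `&` V) xt by split; [apply/KU/LK; right|exact: EV].
  by rewrite UV0.
- have : (U `&` V) xf by split; [exact: EU|apply/KV/LK; left].
  by rewrite UV0.
Qed.

(** * Products and subspaces as spaces in their own right *)

Lemma hausdorff_prod (S T : topologicalType) :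
  hausdorff_space S -> hausdorff_space T -> hausdorff_space (S * T)%type.
Proof.
move=> hS hT [p1 p2] [q1 q2] pq; congr pair.
- apply: hS => B C pB qC.
  have [||x [Bx Cx]] := pq (fst @^-1` B) (fst @^-1` C); try exact: cvg_fst.
  by exists x.1.
- apply: hT => B C pB qC.
  have [||x [Bx Cx]] := pq (snd @^-1` B) (snd @^-1` C); try exact: cvg_snd.
  by exists x.2.
Qed.

Section set_type_topology.
Context {T : topologicalType} (A : set T).

Lemma set_val_continuous : continuous (@set_val T A).
Proof. exact: initial_continuous. Qed.

Lemma continuous_to_set_type (S : topologicalType) (f : S -> A) :
  continuous (set_val \o f) -> continuous f.
Proof. exact: continuous_comp_initial. Qed.

Lemma hausdorff_set_type : hausdorff_space T -> hausdorff_space A.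
Proof.
move=> hT p q pq; apply/val_inj/hT => B C pB qC.
have [x [Bx Cx]] := pq _ _ (set_val_continuous pB) (set_val_continuous qC).
by exists (set_val x).
Qed.

(** Compactness and connectedness pass from the set [A] to the space [A] through this continuous
    image. *)
Lemma setT_image_set_type (a : A) :
  exists2 f : T -> A, {within A, continuous f} & f @` A = [set: A].
Proof.
(* The identity of [A] is extended to [T] with the default value [a] off [A]; continuity within [A]
   ignores the values there. *)
exists (valL_ a idfun); first by apply/subspace_valL_continuousP' => x U.
rewrite -subTset => x _; exists (set_val x); first exact: set_mem (valP x).
exact: (congr1 (@^~ x) (valLK a (idfun : A -> A))).
Qed.

Lemma compact_set_type : compact A -> compact [set: A].
Proof.
(* The proper filter [F] supplies the point of [A] that serves as default value. *)
move=> cA F PF _; have [x _] := filter_ex (filterT : F setT).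
have [f cf fA] := setT_image_set_type x.
by have := continuous_compact cf cA; rewrite fA; apply => //; exact: filterT.
Qed.

Lemma connected_set_type : connected A -> connected [set: A].
Proof.
move=> cA; have [->|/set0P[x _]] := eqVneq [set: A] set0.
  exact: connected0.
have [f cf fA] := setT_image_set_type x.
by rewrite -fA; exact: connected_continuous_connected.
Qed.

End set_type_topology.

(** * The Tychonoff cube and extensions to the Čech-Stone compactification *)

Section tychonoff_cube.
Context {R : realType}.
Implicit Types X Y : topologicalType.

Lemma unit_interval_compact : compact [set: unit_interval R].
Proof. by apply: compact_set_type; exact: segment_compact. Qed.

Lemma unit_interval_hausdorff : hausdorff_space (unit_interval R).
Proof. by apply: hausdorff_set_type; exact: Rhausdorff. Qed.

Lemma tychonoff_cube_compact X : compact [set: tychonoff_cube R X].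
Proof.
have := @tychonoff _ _
  (fun _ : continuousType X (unit_interval R) => [set: unit_interval R]).
move=> /(_ (fun=> unit_interval_compact)).
by congr (compact _); rewrite -subTset => f _ g.
Qed.

Lemma tychonoff_cube_hausdorff X : hausdorff_space (tychonoff_cube R X).
Proof. apply: hausdorff_product => _; exact: unit_interval_hausdorff. Qed.

Lemma continuous_to_cube X Y (F : Y -> tychonoff_cube R X) :
  (forall g, continuous (F^~ g)) -> continuous F.
Proof.
move=> cF y; apply/cvg_sup.
move=> g; move: y.
apply: (@continuous_comp_initial _ _ _ (fun p : tychonoff_cube R X => p g) F).
exact: cF.
Qed.

Lemma unit_function X (f : X -> R) :
  continuous f -> (forall x, 0 <= f x <= 1) ->
  exists g : continuousType X (unit_interval R), forall x, set_val (g x) = f x.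
Proof.
move=> cf f01.
have fI x : f x \in `[0, 1]%classic by rewrite inE /= in_itv /=.
pose g x : unit_interval R := SigSub (fI x).
have cg : continuous g by exact: continuous_to_set_type.
by exists (mkcts cg).
Qed.

Lemma cube_proj_continuous X (g : continuousType X (unit_interval R)) :
  continuous (fun p : tychonoff_cube R X => p g).
Proof.
exact: (@proj_continuous _
  (fun _ : continuousType X (unit_interval R) => unit_interval R)).
Qed.

(** On [cech_stone R X] this is the continuous extension of [g], read as a real function. *)
Definition cube_coord X (g : continuousType X (unit_interval R))
  (p : tychonoff_cube R X) : R := set_val (p g).

Lemma cube_coord_continuous X g : continuous (@cube_coord X g).
Proof.
move=> p.
apply: (@continuous_comp _ _ _ (fun p : tychonoff_cube R X => p g) set_val).
  exact: cube_proj_continuous.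
exact: set_val_continuous.
Qed.

Lemma cech_stone_eval_continuous X : continuous (@cech_stone_eval R X).
Proof. apply: continuous_to_cube => g; exact: cts_fun. Qed.

(** Reindexing coordinates along [s] is defined and continuous on the whole cube; on
    [cech_stone R X] it is the Čech-Stone extension of [s]. *)
Definition cube_map X Y (s : continuousType X Y) (p : tychonoff_cube R X) :
  tychonoff_cube R Y := fun g => p (g \o s).

Lemma cube_map_continuous X Y (s : continuousType X Y) :
  continuous (cube_map s).
Proof.
apply: continuous_to_cube => g.
exact: cube_proj_continuous.
Qed.

Lemma cube_map_eval X Y (s : continuousType X Y) x :
  cube_map s (@cech_stone_eval R _ x) = @cech_stone_eval R _ (s x).
Proof. by []. Qed.

Lemma cech_stone_compact X : compact (cech_stone R X).
Proof.
apply: subclosed_compact (@tychonoff_cube_compact X) _ => //.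
exact: closed_closure.
Qed.

(** The zero set of [u - v] is closed and contains the dense image of [X]. Identities checked on [X]
    thus extend to its compactification. *)
Lemma cech_stone_eq X (u v : tychonoff_cube R X -> R) :
  continuous u -> continuous v ->
  (forall x, u (@cech_stone_eval R _ x) = v (@cech_stone_eval R _ x)) ->
  forall p, cech_stone R X p -> u p = v p.
Proof.
move=> cu cv uv p Xp; apply/eqP; rewrite -subr_eq0; apply/eqP.
suff : closed [set p | u p - v p = 0].
  by apply; apply: closureS Xp => _ [x _ <-] /=; rewrite uv subrr.
apply: (@preimage_closed _ _ (fun p => u p - v p) [set 0]).
  by move=> x _; apply: continuousB; [exact: cu|exact: cv].
exact: closed_eq.
Qed.

End tychonoff_cube.

(** * The remainder of the half line as an intersection of tails *)

Section half_line.
Context {R : realType}.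
Local Notation H := (half_line R).
Local Notation eval := (@cech_stone_eval R H).

(** Truncation at 0 gives a continuous retraction defined on all of [R], through which intervals of
    [R] are carried to [H]. *)
Definition to_half_line (r : R) : H.
Proof.
by exists (Num.max 0 r); rewrite inE /= in_itv /= andbT le_max lexx.
Defined.

Lemma to_half_lineE r : 0 <= r -> set_val (to_half_line r) = r.
Proof. by move=> r0; apply/max_idPr. Qed.

Lemma half_line_ge0 (x : H) : 0 <= set_val x.
Proof. by have := set_mem (valP x); rewrite /= in_itv /= andbT. Qed.

Lemma to_half_lineK (x : H) : to_half_line (set_val x) = x.
Proof. by apply/val_inj/to_half_lineE/half_line_ge0. Qed.

Lemma to_half_line_continuous : continuous to_half_line.
Proof.
apply: continuous_to_set_type => r.
by apply: (@continuous_max _ _ (cst 0) id); [exact: cst_continuous|move=> U].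
Qed.

Lemma half_line_function (phi : R -> R) :
  continuous phi -> (forall t, 0 <= t -> 0 <= phi t <= 1) ->
  exists g : continuousType H (unit_interval R),
    forall x, set_val (g x) = phi (set_val x).
Proof.
move=> cphi phi01; apply: (@unit_function R H (phi \o set_val)).
  by move=> x; apply: continuous_comp; [exact: set_val_continuous|exact: cphi].
by move=> x; exact/phi01/half_line_ge0.
Qed.

(** The closure is taken in the cube; since [cech_stone R H] is closed there, it is also the closure
    in beta H. *)
Definition tail (M : R) : set (tychonoff_cube R H) :=
  closure (eval @` [set x | M <= set_val x]).

Lemma tailS M N : M <= N -> tail N `<=` tail M.
Proof.
move=> MN; apply: closureS => _ [x /= Nx <-]; exists x => //=.
exact: le_trans Nx.
Qed.

(** A ray of [R] is connected, hence so are its image under [eval \o to_half_line] and the closure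
    of that image. *)
Lemma tail_connected M : 0 <= M -> connected (tail M).
Proof.
move=> M0; apply: connected_closure.
have -> : eval @` [set x | M <= set_val x] =
    (eval \o to_half_line) @` `[M, +oo[.
  rewrite eqEsubset; split=> _ [x /= Mx <-].
    by exists (set_val x); rewrite /= ?to_half_lineK// in_itv/= Mx.
  move: Mx; rewrite in_itv/= andbT => Mx.
  by exists (to_half_line x) => //=; rewrite to_half_lineE// (le_trans M0).
apply: connected_continuous_connected.
  by apply/connected_intervalP; exact: interval_is_interval.
apply: continuous_subspaceT => x; apply: continuous_comp.
  exact: to_half_line_continuous.
exact: cech_stone_eval_continuous.
Qed.

(** Beta H is the union of [tail M] and the closure of the image of [0, M]. That image is compact,
    hence closed, so its closure adds no point outside [range eval]. *)
Lemma cech_stone_tail M p :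
  cech_stone R H p -> ~ range eval p -> tail M p.
Proof.
move=> Hp rp.
have : (closure (eval @` [set x | set_val x <= M]) `|` tail M) p.
  rewrite -closureU -image_setU; apply: closureS Hp.
  move=> _ [x _ <-]; exists x => //.
  by have /orP[] := le_total (set_val x) M; [left|right].
case=> // pM; exfalso; apply: rp.
have : closed (eval @` [set x | set_val x <= M]).
  apply: compact_closed; first exact: tychonoff_cube_hausdorff.
  have -> : eval @` [set x | set_val x <= M] =
      (eval \o to_half_line) @` `[0, M].
    rewrite eqEsubset; split=> _ [x /= Mx <-].
      exists (set_val x); rewrite /= ?to_half_lineK//.
      by rewrite in_itv/= Mx half_line_ge0.
    move: Mx; rewrite in_itv/= => /andP[x0 Mx].
    by exists (to_half_line x) => //=; rewrite to_half_lineE.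
  apply: continuous_compact; last exact: segment_compact.
  apply: continuous_subspaceT => x; apply: continuous_comp.
    exact: to_half_line_continuous.
  exact: cech_stone_eval_continuous.
by move=> /(_ _ pM) [x _ <-]; exists x.
Qed.

Lemma half_line_remainderE :
  cech_stone_remainder R H = \bigcap_n tail n%:R.
Proof.
rewrite eqEsubset; split=> p.
  by move=> [Hp rp] n _; exact: cech_stone_tail.
move=> tp; split.
  by apply: closureS (tp 0%N I) => _ [x _ <-]; exists x.
move=> [x _ px].
(* The function exp(-t) excludes a point [x] of [H] from far tails: its extension is at most exp(-n)
   on [tail n%:R], but exceeds this at [x] once [n] is larger than [x]. *)
have [||g gE] := @half_line_function (fun t => expR (- t)).
- move=> t; apply: continuous_comp; last exact: continuous_expR.
  exact: opp_continuous.
- by move=> t t0; rewrite expR_ge0 /= -expR0 ler_expR oppr_le0.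
pose n := (Num.truncn (set_val x)).+1.
have xn : set_val x < n%:R by exact: truncnS_gt.
have : closed [set q | cube_coord g q <= expR (- n%:R)].
  apply: (@preimage_closed _ _ (cube_coord g) [set r | r <= expR (- n%:R)]).
    by move=> q _; exact: cube_coord_continuous.
  exact: closed_le.
move=> cl; have /cl /= : closure [set q | cube_coord g q <= expR (- n%:R)] p.
  apply: closureS (tp n I) => _ [t /= nt <-].
  by rewrite /= /cube_coord /cech_stone_eval gE ler_expR lerN2.
rewrite -px /cube_coord /cech_stone_eval gE ler_expR lerN2 leNgt.
by rewrite xn.
Qed.

Lemma half_line_remainder_nonempty : cech_stone_remainder R H !=set0.
Proof.
rewrite half_line_remainderE; apply: nested_compact_bigcap_nonempty.
- exact: tychonoff_cube_compact.
- by move=> n; exact: closed_closure.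
- by move=> m n mn; apply: tailS; rewrite ler_nat.
- move=> n; exists (eval (to_half_line n%:R)); apply: subset_closure.
  by exists (to_half_line n%:R); rewrite //= to_half_lineE.
Qed.

Lemma half_line_remainder_compact : compact (cech_stone_remainder R H).
Proof.
rewrite half_line_remainderE.
apply: subclosed_compact (@tychonoff_cube_compact R H) _ => //.
by apply: closed_bigI => n _; exact: closed_closure.
Qed.

Lemma half_line_remainder_connected : connected (cech_stone_remainder R H).
Proof.
rewrite half_line_remainderE; apply: (nested_bigcap_connected R).
- exact: tychonoff_cube_hausdorff.
- exact: tychonoff_cube_compact.
- by move=> n; exact: closed_closure.
- by move=> m n mn; apply: tailS; rewrite ler_nat.
- by move=> n; exact: tail_connected.
Qed.

(** * Translation by pi and its extension to the remainder *)

Lemma half_line_shift_continuous :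
  continuous (fun x : H => to_half_line (set_val x + pi)).
Proof.
move=> x.
apply: (@continuous_comp _ _ _ (fun x : H => set_val x + pi) to_half_line).
  by apply: continuousD; [exact: set_val_continuous|exact: cst_continuous].
exact: to_half_line_continuous.
Qed.

Definition half_line_shift : continuousType H H :=
  mkcts half_line_shift_continuous.

Lemma half_line_shiftE x : set_val (half_line_shift x) = set_val x + pi.
Proof. by apply: to_half_lineE; rewrite addr_ge0 ?half_line_ge0// pi_ge0. Qed.

(** Translation only moves points to the right, so its continuous extension maps each tail into
    itself. *)
Lemma half_line_remainder_shift p : cech_stone_remainder R H p ->
  cech_stone_remainder R H (cube_map half_line_shift p).
Proof.
rewrite half_line_remainderE => tp n _ U.
move=> /(@cube_map_continuous R _ _ half_line_shift p) /(tp n I).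
move=> [_ [[x /= nx <-] Ux]].
exists (eval (half_line_shift x)); split => //.
exists (half_line_shift x) => //=.
by rewrite half_line_shiftE (le_trans nx)// lerDl pi_ge0.
Qed.

(** A point [q] of the remainder lies in [tail pi], and [pi, oo) consists of translates. The image
    of beta H is compact, hence closed, so it contains [q]; a preimage in [H] would put [q] in
    [H]. *)
Lemma half_line_remainder_shift_onto q : cech_stone_remainder R H q ->
  exists2 p, cech_stone_remainder R H p & cube_map half_line_shift p = q.
Proof.
move=> [Hq rq]; have := cech_stone_tail pi Hq rq.
have cl : closed (cube_map half_line_shift @` cech_stone R H).
  apply: compact_closed; first exact: tychonoff_cube_hausdorff.
  apply: continuous_compact (@cech_stone_compact R H).
  by apply: continuous_subspaceT; exact: cube_map_continuous.
move=> tq; have /cl [p Hp pq] :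
    closure (cube_map half_line_shift @` cech_stone R H) q.
  apply: closureS tq => _ [x /= pix <-].
  have y0 : 0 <= set_val x - pi by rewrite subr_ge0.
  exists (eval (to_half_line (set_val x - pi))).
    by apply: subset_closure; exists (to_half_line (set_val x - pi)).
  rewrite cube_map_eval; congr (eval _); apply/val_inj.
  by rewrite [LHS]half_line_shiftE to_half_lineE// subrK.
exists p => //; split => // -[x _ xp]; apply: rq.
by exists (half_line_shift x) => //; rewrite -pq -xp.
Qed.

Lemma half_line_shift_no_fixpoint p :
  cech_stone R H p -> cube_map half_line_shift p <> p.
Proof.
move=> Hp fixp.
(* Rescaling from [-1, 1] to [0, 1] turns cos and sin into coordinates of the cube; the sign change
   becomes the reflection of [0, 1] about 1/2. *)
have half_cont (phi : R -> R) :
    continuous phi -> continuous (fun t => (1 + phi t) / 2).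
  move=> cphi t; apply: cvgM; last exact: cvg_cst.
  by apply: cvgD; [exact: cvg_cst|exact: cphi].
have [||c cE] := @half_line_function (fun t => (1 + cos t) / 2).
- exact/half_cont/continuous_cos.
- by move=> t _; have := cos_le1 t; have := cos_geN1 t; lra.
have [||s sE] := @half_line_function (fun t => (1 + sin t) / 2).
- exact/half_cont/continuous_sin.
- by move=> t _; have := sin_le1 t; have := sin_geN1 t; lra.
(* The reflection identity extends from [H] to beta H; at the fixed point [p] it forces the
   coordinate to be 1/2. *)
have flip (g : continuousType H (unit_interval R)) :
    (forall x, set_val (g (half_line_shift x)) = 1 - set_val (g x)) ->
    cube_coord g p = 1 - cube_coord g p.
  move=> gs; rewrite -[in LHS]fixp.
  apply: (@cech_stone_eq _ _ (cube_coord g \o cube_map half_line_shift)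
    (fun p => 1 - cube_coord g p) _ _ _ _ Hp).
  - move=> q; apply: continuous_comp; first exact: cube_map_continuous.
    exact: cube_coord_continuous.
  - move=> q; apply: continuousB; first exact: cst_continuous.
    exact: cube_coord_continuous.
  - exact: gs.
have c_half : cube_coord c p = 1 - cube_coord c p.
  by apply: flip => x; rewrite !cE half_line_shiftE cosDpi; lra.
have s_half : cube_coord s p = 1 - cube_coord s p.
  by apply: flip => x; rewrite !sE half_line_shiftE sinDpi; lra.
(* Undoing the rescaling, the Pythagorean identity also extends to beta H. Both squares vanish at
   [p], so it would read 0 = 1. *)
have cs1 : (2 * cube_coord c p - 1) ^+ 2 + (2 * cube_coord s p - 1) ^+ 2 = 1.
  apply: (@cech_stone_eq _ _
    (fun p => (2 * cube_coord c p - 1) ^+ 2 + (2 * cube_coord s p - 1) ^+ 2)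
    (cst 1) _ _ _ _ Hp).
  - move=> q.
    have sq_cont : continuous (fun r : R => (2 * r - 1) ^+ 2).
      move=> r; apply: (@continuous_comp _ _ _
        (fun r : R => 2 * r - 1) (fun r : R => r ^+ 2)).
        by apply: cvgB; [apply: cvgM => //; exact: cvg_cst|exact: cvg_cst].
      exact: exprn_continuous.
    have coord_cont g :
        continuous (fun q => (2 * @cube_coord R H g q - 1) ^+ 2).
      move=> r; apply: (@continuous_comp _ _ _ (cube_coord g)
        (fun r => (2 * r - 1) ^+ 2)); first exact: cube_coord_continuous.
      exact: sq_cont.
    exact: (continuousD (@coord_cont c q) (@coord_cont s q)).
  - exact: cst_continuous.
  - move=> x; rewrite /cube_coord /cech_stone_eval cE sE /=.
    rewrite -[RHS](cos2Dsin2 (set_val x)).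
    by field.
have c0 : 2 * cube_coord c p - 1 = 0 by lra.
have s0 : 2 * cube_coord s p - 1 = 0 by lra.
by move: cs1; rewrite c0 s0 expr0n addr0 => /esym/eqP; rewrite oner_eq0.
Qed.

End half_line.

Theorem corollary3p2 (R : realType) :
  ~ surjective_span_zero (half_line_remainder R) /\
  exists Z : set (half_line_remainder R * half_line_remainder R),
    [/\ is_continuum Z,
        fst @` Z = [set: half_line_remainder R],
        snd @` Z = [set: half_line_remainder R]
      & Z `&` diagonal = set0].
Proof.
suff [Z [cZ Z1 Z2 Z0]] :
    exists Z : set (half_line_remainder R * half_line_remainder R),
      [/\ is_continuum Z, fst @` Z = setT, snd @` Z = setT
        & Z `&` diagonal = set0].
  by split; [move=> /(_ Z cZ Z1 Z2); rewrite Z0 => -[]|exists Z].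
pose shift : continuousType (half_line R) (half_line R) := half_line_shift.
have shiftP (p : half_line_remainder R) :
    cube_map shift (set_val p) \in cech_stone_remainder R (half_line R).
  by apply/mem_set/half_line_remainder_shift/set_mem/(valP p).
(* [T] is the extended translation, restricted to a self-map of the remainder. *)
pose T p : half_line_remainder R := SigSub (shiftP p).
have T_continuous : continuous T.
  apply: continuous_to_set_type => p.
  apply: (@continuous_comp _ _ _ set_val (cube_map shift)).
    exact: set_val_continuous.
  exact: cube_map_continuous.
pose graph p := (p, T p).
have graph_continuous : {within [set: half_line_remainder R], continuous graph}.
  apply: continuous_subspaceT => p.
  apply: (@cvg_pair _ _ _ (nbhs p) (nbhs p) (nbhs (T p)) _ _ _ id T).
    exact: cvg_id.
  exact: T_continuous.
(* The graph is compact and connected as a continuous image of the remainder. Its second projection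
   is onto because [T] is, and a point on the diagonal would be a fixed point of [T]. *)
exists (range graph); split.
- split.
  + have [p Hp] := @half_line_remainder_nonempty R.
    by exists (graph (SigSub (mem_set Hp))); exists (SigSub (mem_set Hp)).
  + apply: continuous_compact graph_continuous _.
    exact/compact_set_type/half_line_remainder_compact.
  + apply: connected_continuous_connected graph_continuous.
    exact/connected_set_type/half_line_remainder_connected.
  + apply: hausdorff_set_type; apply: hausdorff_prod;
    exact/hausdorff_set_type/tychonoff_cube_hausdorff.
- by rewrite -subTset => p _; exists (graph p); [exists p|].
- rewrite -subTset => q _.
  have [p Hp pq] := half_line_remainder_shift_onto (set_mem (valP q)).
  exists (graph (SigSub (mem_set Hp))); first by exists (SigSub (mem_set Hp)).
  exact/val_inj.
- rewrite -subset0 => _ [[p _ <-]] /= Tp.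
  have [Hp _] := set_mem (valP p).
  exact: half_line_shift_no_fixpoint Hp (congr1 set_val (esym Tp)).
Qed.
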